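(* Let $A$ be an S$^*$-base of a frame $L$. The following are equivalent. (1) $L$ is $A$-extremal (that is, $A$, in its own order, is a frame). (2) $A=D_\infty A$. (3) $k$ is a nucleus on $L$ and $A=\mathrm{fix}(k)$. (4) $k=j$ and $A=\mathrm{fix}(j)$. (5) The embedding $A\hookrightarrow L$ has a left exact left adjoint.
   Context: A subset $A$ of a frame $L$ is a base if every element of $L$ is a join of elements of $A$; it is an S-base if it is a base and a meet-semilattice whose binary meets agree with those of $L$; it is an S$^*$-base if moreover $A$ is bounded. $L$ is $A$-extremal if $A$ is a frame in its own (induced) order; joins in $A$ need not agree with joins in $L$. A subset $G\subseteq A$ is admissible if $\bigvee G$ exists in $A$ and for each $a\in A$ the join $\bigvee\{a\wedge y: y\in G\}$ exists in $A$ and equals $a\wedge\bigvee G$. A downset $E$ of $A$ is a D-ideal if $\bigvee G\in E$ for each admissible $G\subseteq E$. $D_\infty A$ is the frame of D-ideals of $A$ under inclusion, and $A$ is identified with its image $\{{\downarrow}a:a\in A\}\subseteq D_\infty A$. $k=k_L^A:L\to L$ is $k(x)=\bigwedge_L\{a\in A: x\le a\}$, with set of fixpoints $\mathrm{fix}(k)$. $j=j_L^A:L\to L$ is $j(x)=\bigwedge_L\{(x\to c)\to c: c\in\mathrm{fix}(k)\}$, where $\to$ is the Heyting implication of $L$; $\mathrm{fix}(j)$ is its set of fixpoints. A left adjoint between meet-semilattices is left exact if it preserves binary meets. *)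

(* Defs.v *)
From HB Require Import structures.
From mathcomp Require Import all_boot all_order.
From mathcomp Require Import boolp classical_sets.

Set Implicit Arguments.
Unset Strict Implicit.
Unset Printing Implicit Defensive.

Import Order.TTheory.

Local Open Scope classical_set_scope.
Local Open Scope order_scope.

(* The induced order on a subset [A] of a poset, seen as the type
   [set_type A]. *)
HB.instance Definition _ (d : Order.disp_t) (L : porderType d) (A : set L) :=
  [SubChoice_isSubPOrder of {x : L | x \in A} by <: with d].

Section Posets.
Context {d : Order.disp_t} {P : porderType d}.
Implicit Types (a g : P) (E G : set P).

(* {a /\ y : y in G}; binary meets are described relationally because [P] will
   be a subset of a frame, which carries no canonical meet operation. *)
Definition meets_with a G : set P :=
  [set z | exists2 y, G y & infimums [set a; y] z].

(* The finite meets needed for a frame exist as soon as all joins do. *)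
Definition is_frame : Prop :=
  (forall G, exists g, supremums G g) /\
  (forall a G g m, supremums G g -> infimums [set a; g] m ->
     supremums (meets_with a G) m).

Definition has_bounds : Prop :=
  (exists b : P, lbound setT b) /\ (exists t : P, ubound setT t).

Definition admissible G : Prop :=
  exists2 g, supremums G g &
    forall a, exists2 m, infimums [set a; g] m & supremums (meets_with a G) m.

Definition D_ideal E : Prop :=
  (forall a b, E a -> b <= a -> E b) /\
  (forall G g, admissible G -> G `<=` E -> supremums G g -> E g).

Definition D_infty : set (set P) := [set E | D_ideal E].

Definition principal a : set P := [set b | b <= a].

End Posets.
Arguments is_frame {d} P.
Arguments has_bounds {d} P.
Arguments D_infty {d} P.

Definition left_adjoint {d d' : Order.disp_t} {P : porderType d}
    {Q : porderType d'} (f : P -> Q) (g : Q -> P) : Prop :=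
  forall x a, f x <= a <-> x <= g a.

Definition left_exact {d d' : Order.disp_t} {P : porderType d}
    {Q : porderType d'} (f : P -> Q) : Prop :=
  forall x y m, infimums [set x; y] m -> infimums [set f x; f y] (f m).

Section Frames.
Context {d : Order.disp_t} {L : tbLatticeType d}.
Implicit Types (x y c : L) (S A : set L).

(* The default value [\top] makes the empty meet equal to [\top]. *)
Definition bigmeet S : L := infimum \top S.

Definition heyting x y : L := supremum \bot [set z | z `&` x <= y].

Definition fix_set (f : L -> L) : set L := [set x | f x = x].

Definition nucleus (f : L -> L) : Prop :=
  [/\ forall x, x <= f x,
      forall x, f (f x) = f x &
      forall x y, f (x `&` y) = f x `&` f y].

Definition is_base A : Prop :=
  forall x, exists2 G, G `<=` A & supremums G x.

Definition is_S_base A : Prop :=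
  is_base A /\
  forall a b : set_type A,
    exists2 m : set_type A, infimums [set a; b] m & val m = val a `&` val b.

Definition is_Sstar_base A : Prop := is_S_base A /\ has_bounds (set_type A).

Definition extremal A : Prop := is_frame (set_type A).

Definition kmap A x : L := bigmeet [set a | A a /\ x <= a].

Definition jmap A x : L :=
  bigmeet [set heyting (heyting x c) c | c in fix_set (kmap A)].

Lemma bigmeetP S : is_frame L -> infimums S (bigmeet S).
Proof.
move=> [sup _]; rewrite /bigmeet /infimum.
case: eqP => [->|_]; first by split=> [x []|x _]; rewrite ?lex1.
case: xgetP => [y _ //|noinf].
have [g [gub glub]] := sup (lbound S).
exfalso; apply: (noinf g); split=> [x Sx|x]; last exact: gub.
by apply: glub => y yS; apply: yS.
Qed.

Lemma heytingP x y z : is_frame L -> z <= heyting x y <-> z `&` x <= y.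
Proof.
move=> [sup dist]; rewrite /heyting; set G := [set t | _].
have infI (a b : L) : infimums [set a; b] (a `&` b).
  split=> [t [->|->]|t lt]; rewrite ?leIl ?leIr // lexI.
  by rewrite !lt //; [right|left].
have supG : supremums G (supremum \bot G).
  rewrite /supremum; case: eqP => [G0|_].
    have : G \bot by rewrite /G /= meet0x le0x.
    by rewrite G0.
  case: xgetP => [//|nosup]; have [g gP] := sup G.
  by case: (nosup g).
split=> [zG|zxy]; last exact: supG.1.
have [_ lubm] := dist _ _ _ _ supG (infI x _).
apply: (@le_trans _ _ (x `&` supremum \bot G)); first by rewrite meetC leI2.
apply: lubm => t [u Gu [tlb _]]; apply: le_trans Gu.
by rewrite lexI !tlb //; [left|right].
Qed.

End Frames.

(* Main.v *)
Require Import Defs.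
From mathcomp Require Import all_boot all_order.
From mathcomp Require Import boolp classical_sets.

(** The five conditions are linked in a cycle, in the order in which they are
    listed.  All of it rests on the Heyting implication of [L] and on the fact
    that an element [x] of [L] is determined by its trace [{a : A | a <= x}].

    If [A] is a frame, every subset of [A] is admissible, so a D-ideal contains
    its own join and is principal.  Conversely, if every D-ideal is principal,
    then [x] belongs to [A] as soon as its trace is a D-ideal
    ([mem_of_trace_D_ideal]).  The traces of [k x] and of [y -> c], with [c] in
    [A], are D-ideals, the latter because admissible joins distribute over
    binary meets.  So [k] takes its values in [A], and [A] is an exponential
    ideal of [L].  A closure operator whose fixpoints form an exponential ideal
    preserves binary meets, by currying one variable at a time
    ([kmap_meet_of_exponential]); hence [k] is a nucleus.

    The operator [j] always lies below [k], since the choice [c = k x] makes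
    [(x -> c) -> c] equal to [k x].  A nucleus [k] satisfies
    [k x /\ (x -> c) <= k (x /\ (x -> c)) <= c] for each fixpoint [c], hence
    lies below [j], so that the two agree.  If [k = j], then [x /\ y <= c] yields
    [y <= x -> c] and thus [k x /\ y <= c] for each fixpoint [c]; the same
    currying argument shows that [k], corestricted to [A], is left exact, and
    it is left adjoint to the embedding by construction.  Finally, a left
    adjoint computes joins in [A] as the images of the joins in [L], and its
    left exactness transports the distributive law from [L] to [A]. *)

Set Implicit Arguments.
Unset Strict Implicit.
Unset Printing Implicit Defensive.

Import Order.TTheory.

Local Open Scope classical_set_scope.
Local Open Scope order_scope.

(** * Meets in A and traces on A *)

Section Lattice.
Context {d : Order.disp_t} {L : tbLatticeType d}.
Implicit Types (x y c : L) (A : set L).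

Lemma infimums2_meet x y : infimums [set x; y] (x `&` y).
Proof.
split=> [t [->|->]|t lt]; rewrite ?leIl ?leIr // lexI.
by rewrite !lt //; [right|left].
Qed.

Lemma infimums2_unique x y m : infimums [set x; y] m -> m = x `&` y.
Proof.
move=> [mlb mglb]; have [lb glb] := infimums2_meet x y.
by apply/eqP; rewrite eq_le glb //= mglb.
Qed.

Section Base.
Variables (A : set L).

Lemma le_set_typeE (a b : set_type A) : (a <= b) = (val a <= val b).
Proof. by []. Qed.

Lemma set_type_mem (a : set_type A) : A (val a).
Proof. exact: set_mem (valP a). Qed.

Lemma exists_set_type x : A x -> exists a : set_type A, val a = x.
Proof. by move=> Ax; exists (exist _ x (mem_set Ax)). Qed.

Lemma le_of_trace x y : is_base A ->
  (forall a : set_type A, val a <= x -> val a <= y) -> x <= y.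
Proof.
move=> base xy; have [G GA [Gub Glub]] := base x.
apply: Glub => a Ga; have [a' ea] := exists_set_type (GA _ Ga).
by rewrite -ea; apply: xy; rewrite ea; apply: Gub.
Qed.

Lemma set_type_infimums2 (a b m : set_type A) : is_S_base A ->
  infimums [set a; b] m -> val m = val a `&` val b.
Proof.
move=> [_ SA] [mlb mglb]; have [n [nlb nglb] <-] := SA a b.
by congr val; apply/eqP; rewrite eq_le nglb //= mglb.
Qed.

Lemma set_type_meet (a b : set_type A) : is_S_base A ->
  exists2 m : set_type A, infimums [set a; b] m & val m = val a `&` val b.
Proof. by case. Qed.

End Base.
End Lattice.

(** * The closure operator k *)

Section Closure.
Context {d : Order.disp_t} {L : tbLatticeType d}.
Variables (A : set L) (frL : is_frame L).
Implicit Types (x y c : L).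

Lemma kmap_ge x : x <= kmap A x.
Proof. by apply: (bigmeetP _ frL).2 => a []. Qed.

Lemma kmap_le x c : A c -> x <= c -> kmap A x <= c.
Proof. by move=> Ac xc; apply: (bigmeetP _ frL).1. Qed.

Lemma le_kmap x y :
  (forall a, A a -> x <= a -> y <= a) -> y <= kmap A x.
Proof. by move=> xy; apply: (bigmeetP _ frL).2 => a []; apply: xy. Qed.

Lemma kmap_id c : A c -> kmap A c = c.
Proof. by move=> Ac; apply/eqP; rewrite eq_le kmap_ge kmap_le. Qed.

Lemma kmap_idem x : kmap A (kmap A x) = kmap A x.
Proof.
apply/eqP; rewrite eq_le kmap_ge andbT.
by apply: le_kmap => a Aa xa; apply: kmap_le => //; apply: kmap_le.
Qed.

Lemma kmap_mono x y : x <= y -> kmap A x <= kmap A y.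
Proof.
by move=> xy; apply: le_kmap => a Aa ya; apply: kmap_le => //; apply: le_trans ya.
Qed.

(** The hypothesis says that [k x] remains below every [y -> c] above [x],
    which holds when [y -> c] is in [A] and also when [k = j].  Using it once in
    each variable bounds [k x /\ k y] by every element of [A] above
    [x /\ y]. *)
Lemma kmap_meet_of_exponential :
    (forall x y c, A c -> x `&` y <= c -> kmap A x `&` y <= c) ->
  forall x y, kmap A (x `&` y) = kmap A x `&` kmap A y.
Proof.
move=> expA x y; apply/eqP; rewrite eq_le lexI.
rewrite !kmap_mono ?leIl ?leIr //=.
apply: le_kmap => c Ac xyc.
by rewrite meetC; apply: (expA) => //; rewrite meetC; apply: expA.
Qed.

(** * Comparison of k and j *)

Lemma le_jmap x y :
  (forall c, kmap A c = c -> y `&` heyting x c <= c) -> y <= jmap A x.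
Proof.
move=> xy; apply: (bigmeetP _ frL).2 => _ [c kc <-].
by apply/heytingP => //; apply: xy.
Qed.

Lemma jmap_meet_heyting x c : kmap A c = c -> jmap A x `&` heyting x c <= c.
Proof.
by move=> kc; apply/heytingP => //; apply: (bigmeetP _ frL).1; exists c.
Qed.

Lemma jmap_le_kmap x : jmap A x <= kmap A x.
Proof.
apply: le_trans (jmap_meet_heyting x (kmap_idem x)).
rewrite lexI lexx /=; apply/heytingP => //.
exact: le_trans (leIr _ _) (kmap_ge x).
Qed.

Lemma jmap_meet_le x y c :
  kmap A c = c -> x `&` y <= c -> jmap A x `&` y <= c.
Proof.
move=> kc xyc; apply: le_trans (jmap_meet_heyting x kc).
by apply: leI2 => //; apply/heytingP => //; rewrite meetC.
Qed.

Lemma kmap_eq_jmap : nucleus (kmap A) -> kmap A = jmap A.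
Proof.
move=> [_ _ kI]; apply: funext => x; apply/eqP; rewrite eq_le jmap_le_kmap andbT.
apply: le_jmap => c kc.
apply: (@le_trans _ _ (kmap A (x `&` heyting x c))).
  by rewrite kI leI2 ?kmap_ge.
by rewrite -[leRHS]kc kmap_mono // meetC; apply/heytingP.
Qed.

End Closure.

(** * D-ideals *)

Section DIdeals.
Context {d : Order.disp_t} {P : porderType d}.

Lemma principal_D_ideal (a : P) : D_ideal (principal a).
Proof.
split=> [b c|G g _ Ga [_ glub]]; first by move=> ba cb; apply: le_trans ba.
exact: glub.
Qed.

Lemma frame_D_infty :
    (forall a b : P, exists m, infimums [set a; b] m) ->
  is_frame P -> range (@principal d P) = D_infty P.
Proof.
move=> meet [sup dist]; apply/seteqP; split=> [_ [a _ <-]|E [Edown Esup]].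
  exact: principal_D_ideal.
have [g supg] := sup E.
have Eg : E g.
  apply: (Esup E) => //; exists g => // a; have [m infm] := meet a g.
  by exists m => //; apply: dist infm.
exists g => //; apply/seteqP; split=> b; first exact: Edown.
by move=> Eb; apply: supg.1.
Qed.

End DIdeals.

Section Traces.
Context {d : Order.disp_t} {L : tbLatticeType d}.
Variables (A : set L) (frL : is_frame L) (SA : is_S_base A).
Implicit Types (x y c : L).

Let trace x : set (set_type A) := [set a | val a <= x].

Lemma mem_of_trace_D_ideal x :
    range (@principal d (set_type A)) = D_infty (set_type A) ->
  D_ideal (trace x) -> A x.
Proof.
move=> prA Dx; have : D_infty (set_type A) (trace x) by [].
rewrite -prA => -[a _ ax].
have axE (b : set_type A) : principal a b <-> trace x b by rewrite ax.
suff -> : x = val a by apply: set_type_mem.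
apply/eqP; rewrite eq_le; apply/andP; split; last exact/axE/(lexx a).
by apply: (le_of_trace SA.1) => b /axE.
Qed.

(** This trace is an intersection of principal downsets. *)
Lemma kmap_trace_D_ideal x : D_ideal (trace (kmap A x)).
Proof.
split=> [a b|G g _ Gx [_ glub]]; first by move=> ax ba; apply: le_trans ax.
apply: le_kmap => // c Ac xc; have [c' ec] := exists_set_type Ac.
rewrite -ec -le_set_typeE; apply: glub => b Gb; rewrite le_set_typeE ec.
exact: le_trans (Gx _ Gb) (kmap_le frL Ac xc).
Qed.

(** Admissible joins are compatible with meets with elements of [A] only, so
    [y] is first replaced by the elements of the base below it. *)
Lemma heyting_trace_D_ideal y c : A c -> D_ideal (trace (heyting y c)).
Proof.
move=> Ac; split=> [a b|G g [g' supg' distG] Gy supg].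
  by move=> ay ba; apply: le_trans ay.
have -> : g = g'.
  by apply/eqP; rewrite eq_le supg.2 ?supg'.2 //; [apply: supg.1|apply: supg'.1].
apply/heytingP => //; rewrite meetC; apply/(heytingP _ _ _ frL).
apply: (le_of_trace SA.1) => a ay; apply/heytingP => //.
have [c' ec] := exists_set_type Ac.
have [m infm [_ mlub]] := distG a.
rewrite -(set_type_infimums2 SA infm) -ec -le_set_typeE.
apply: mlub => z [b Gb infz]; rewrite le_set_typeE ec.
rewrite (set_type_infimums2 SA infz) meetC.
apply: (@le_trans _ _ (val b `&` y)); first exact: leI2.
by apply/heytingP => //; apply: Gy.
Qed.

Lemma kmap_nucleus_of_D_infty :
    range (@principal d (set_type A)) = D_infty (set_type A) ->
  nucleus (kmap A) /\ A = fix_set (kmap A).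
Proof.
move=> prA; split; last first.
  apply/seteqP; split=> [c|x kx]; first exact: kmap_id.
  rewrite -kx; apply: mem_of_trace_D_ideal => //; exact: kmap_trace_D_ideal.
split=> [x|x|]; [exact: kmap_ge|exact: kmap_idem|].
apply: kmap_meet_of_exponential => // x y c Ac xyc.
apply/heytingP => //; apply: kmap_le => //; last exact/heytingP.
apply: mem_of_trace_D_ideal => //; exact: heyting_trace_D_ideal.
Qed.

(** * The left adjoint of the embedding *)

Lemma left_exact_left_adjoint :
    kmap A = jmap A -> A = fix_set (jmap A) ->
  exists2 f : L -> set_type A,
    left_adjoint f (val : set_type A -> L) & left_exact f.
Proof.
move=> kj Aj; have Ak x : A (kmap A x).
  have : fix_set (jmap A) (kmap A x) by rewrite -kj /fix_set /= kmap_idem.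
  by rewrite -Aj.
exists (fun x => exist _ (kmap A x) (mem_set (Ak x)) : set_type A).
  move=> x a; rewrite le_set_typeE /=; split; first exact/le_trans/kmap_ge.
  by move=> xa; apply: kmap_le => //; apply: set_type_mem.
move=> x y m /infimums2_unique ->.
have kI : kmap A (x `&` y) = kmap A x `&` kmap A y.
  apply: kmap_meet_of_exponential => // {}x {}y c Ac xyc.
  by rewrite kj; apply: jmap_meet_le => //; apply: kmap_id.
split=> [t [->|->]|t lt]; rewrite le_set_typeE /= kI ?leIl ?leIr // lexI.
by apply/andP; split; [apply: (lt _ (or_introl erefl))
                      |apply: (lt _ (or_intror erefl))].
Qed.

(** Joins in [A] are the reflections of joins in [L]; a meet [a /\ g] in [A]
    is bounded by [f a /\ f (\/ G) = f (a /\ \/ G)], where the distributivity of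
    [L] applies. *)
Lemma frame_of_left_adjoint (f : L -> set_type A) :
    left_adjoint f (val : set_type A -> L) -> left_exact f ->
  is_frame (set_type A).
Proof.
move=> adj lex; have unit x : x <= val (f x) by apply/adj.
have supA (G : set (set_type A)) (s : L) :
    supremums (val @` G) s -> supremums G (f s).
  move=> [sub slub]; split=> [a Ga|a aub].
    by rewrite le_set_typeE (le_trans _ (unit s)) // sub //; exists a.
  by apply/adj; apply: slub => _ [b Gb <-]; rewrite -le_set_typeE; apply: aub.
split=> [G|a G g m supg infm].
  by have [s sups] := frL.1 (val @` G); exists (f s); apply: supA.
have em := set_type_infimums2 SA infm.
split=> [z [b Gb infz]|c cub].
  rewrite le_set_typeE em (set_type_infimums2 SA infz) leI2 //.
  by rewrite -le_set_typeE supg.1.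
have [s sups] := frL.1 (val @` G).
have infs := infimums2_meet (val a) s.
apply: (@le_trans _ _ (f (val a `&` s))).
  apply: (lex _ _ _ infs).2 => _ [->|->].
    by rewrite le_set_typeE em (le_trans (leIl _ _)).
  apply: le_trans (supg.2 _ (supA _ _ sups).1).
  by rewrite le_set_typeE em leIr.
apply/adj; apply: (frL.2 _ _ _ _ sups infs).2 => z [_ [b Gb <-]].
move=> /infimums2_unique ->; have [n infn <-] := set_type_meet a b SA.
by rewrite -le_set_typeE; apply: cub; exists b.
Qed.

End Traces.

Theorem theorem4p4 (d : Order.disp_t) (L : tbLatticeType d) (A : set L)
    (frL : is_frame L) (SA : is_Sstar_base A) :
  [<-> extremal A;
       range (@principal d (set_type A)) = D_infty (set_type A);
       nucleus (kmap A) /\ A = fix_set (kmap A);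
       kmap A = jmap A /\ A = fix_set (jmap A);
       exists2 f : L -> set_type A,
         left_adjoint f (val : set_type A -> L) & left_exact f].
Proof.
have [Sb _] := SA; tfae.
- by apply: frame_D_infty => a b; have [m] := set_type_meet a b Sb; exists m.
- exact: kmap_nucleus_of_D_infty.
- by move=> [nk Ak]; rewrite -(kmap_eq_jmap frL nk).
- by move=> [kj Aj]; apply: left_exact_left_adjoint.
- by move=> [f adj lex]; apply: frame_of_left_adjoint adj lex.
Qed.
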